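(* (Dieudonné's lemma for $\mathbf{nbal}$.) Suppose $(A,\prec)\in\mathbf{nbal}$ and identify $(A,\prec)$ with its image in $(C(X_A),\prec_{X_A})$ under the embedding $\phi_A:A\to C(X_A)$. Let $S$ be the closure of $\mathscr R(A,\prec)$ in $C(X_A)$, and let $\prec'$ be the closure of $\prec$ in $C(X_A)\times C(X_A)$. Then $S\in\mathbf{sbal}$ (with the operations and order of $C(X_A)$) and ${\prec'}={\prec_S}$.
   Context: All rings are commutative with $1$ and ring homomorphisms are unital. An $\ell$-ring is a ring $A$ with a lattice order such that $a\le b$ implies $a+c\le b+c$, and $0\le a,b$ implies $0\le ab$. It is bounded if for each $a$ there is $n\in\mathbb N$ with $-n\cdot1\le a\le n\cdot1$, and archimedean if whenever $na\le b$ for all $n\in\mathbb N$, then $a\le0$. An $\ell$-algebra is an $\ell$-ring that is an $\mathbb R$-algebra with $ra\ge0$ whenever $0\le a\in A$ and $0\le r\in\mathbb R$. $\mathbf{bal}$ is the category of bounded archimedean $\ell$-algebras and unital $\ell$-algebra homomorphisms; $r\in\mathbb R$ is identified with $r\cdot1\in A$. Put $|a|=a\vee(-a)$ and $\|a\|=\inf\{r\in\mathbb R:|a|\le r\}$; closures and density refer to this (uniform) norm. $\mathbb R^+=[0,\infty)$. A reflexive proximity on $A\in\mathbf{bal}$ is a binary relation $\prec$ such that: (P1) $a\prec b$ implies $a\le b$; (P2) $a\le b\prec c\le d$ implies $a\prec d$; (P3) $a\prec b,c$ implies $a\prec b\wedge c$; (P4) $a,b\prec c$ implies $a\vee b\prec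 c$; (RP5) $a\prec b$ implies there is $c$ with $a\prec c\prec c\prec b$; (P6) $a\prec b$ and $c\prec d$ imply $a+c\prec b+d$; (P7) if $0\le a,b,c,d$, $a\prec b$ and $c\prec d$, then $ac\prec bd$; (P8) $r\prec r$ for $r\in\mathbb R$; (P9) $a\prec b$ and $r\in\mathbb R^+$ imply $ra\prec rb$. Put $\mathscr R(A,\prec)=\{c\in A:c\prec c\}$. $\mathbf{nbal}$ consists of the pairs $(A,\prec)$ with $A\in\mathbf{bal}$ and $\prec$ a reflexive proximity on $A$ such that $\{c-d:c,d\in\mathscr R(A,\prec)\}$ is uniformly dense in $A$. An ideal $I$ of $A$ is an $\ell$-ideal if $|a|\le|b|$, $b\in I$ imply $a\in I$. $X_A$ is the (compact Hausdorff) space of maximal $\ell$-ideals of $A$, with closed sets $\{x\in X_A:I\subseteq x\}$ for $I$ an $\ell$-ideal. For $y\in X_A$ let ${\Downarrow}y=\{a\in A:\exists c\in y\cap\mathscr R(A,\prec),\ c\ge0,\ |a|\le c\}$ and order $X_A$ by $x\le y\iff{\Downarrow}y\subseteq x$. $C(X_A)$ is the algebra of continuous real-valued functions on $X_A$, $C_\le(X_A)$ its subset of order-preserving functions, and $f\prec_{X_A}g$ iff there is $c\in C_\le(X_A)$ with $f\le c\le g$. The embedding $\phi_A:A\to C(X_A)$ is given by $\phi_A(a)(x)=r$, where $r$ is the unique real number with $a+x=r+x$ in $A/x\cong\mathbb R$. For $B\in\mathbf{bal}$ and $S\subseteq B$, define $\prec_S$ on $B$ by $a\prec_S b\iff\exists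 s\in S:\ a\le s\le b$ (here $B=C(X_A)$). An $\ell$-monoid is a commutative monoid $(S,+,0)$ with a lattice order such that $a\le b\iff a+c\le b+c$, $(a\vee b)+c=(a+c)\vee(b+c)$ and $(a\wedge b)+c=(a+c)\wedge(b+c)$. Let $S^+=\{a\in S:a\ge0\}$. $S$ is an $\ell$-semialgebra if there is a commutative associative multiplication on $S^+$ with identity $1$; $a(b+c)=ab+ac$ on $S^+$; $a\le b$ implies $ac\le bc$ for $a,b,c\in S^+$; and there is a unital map $\rho:\mathbb R\to S$ preserving $+,\vee,\wedge$ and multiplication (of nonnegative elements). $S\in\mathbf{sbal}$ means that moreover $S$ is bounded (for each $a$ there is $r\in\mathbb R^+$ with $\rho(-r)\le a\le\rho(r)$) and archimedean ($na+b\le nc+d$ for all $n\in\mathbb N$ implies $a\le c$). *)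

(* Defs.v *)
From HB Require Import structures.
From mathcomp Require Import all_boot all_order all_algebra.
From mathcomp Require Import all_classical all_reals all_analysis.
From mathcomp Require Import ring lra.

Set Implicit Arguments.
Unset Strict Implicit.
Unset Printing Implicit Defensive.
Set SsrOldRewriteGoalsOrder.

Import Order.TTheory GRing.Theory Num.Theory.
Import numFieldNormedType.Exports.

Local Open Scope classical_set_scope.
Local Open Scope ring_scope.

(* The zero ring is an l-algebra, hence pzRing.  The order and the scaling are
   fields of the mixin, not inherited, because Hierarchy Builder does not accept
   a new common child of rings and orders, or of pzRings and modules, below
   [numDomainType] and [algType]; the library's lattice and module structures
   are recovered just after. *)
HB.mixin Record isLAlgebra (R : realType) A of GRing.ComPzRing A := {
  lalg_le : rel A;
  lalg_meet : A -> A -> A;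
  lalg_join : A -> A -> A;
  lalg_lexx : reflexive lalg_le;
  lalg_le_anti : antisymmetric lalg_le;
  lalg_le_trans : transitive lalg_le;
  lalg_meetP : forall a b c,
    lalg_le a (lalg_meet b c) = lalg_le a b && lalg_le a c;
  lalg_joinP : forall a b c,
    lalg_le (lalg_join a b) c = lalg_le a c && lalg_le b c;
  lalg_leD : forall a b c, lalg_le a b -> lalg_le (a + c) (b + c);
  lalg_mul_ge0 : forall a b, lalg_le 0 a -> lalg_le 0 b -> lalg_le 0 (a * b);
  lalg_scale : R -> A -> A;
  lalg_scaleA : forall r s a,
    lalg_scale r (lalg_scale s a) = lalg_scale (r * s) a;
  lalg_scale1 : left_id 1 lalg_scale;
  lalg_scaleDr : right_distributive lalg_scale +%R;
  lalg_scaleDl : forall a, {morph lalg_scale^~ a : r s / r + s};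
  lalg_scaleAl : forall r a b, lalg_scale r (a * b) = lalg_scale r a * b;
  lalg_scale_ge0 : forall r a, 0 <= r -> lalg_le 0 a -> lalg_le 0 (lalg_scale r a)
}.

#[short(type="lAlgType")]
HB.structure Definition LAlgebra (R : realType) :=
  {A of isLAlgebra R A & GRing.ComPzRing A}.

HB.instance Definition _ (R : realType) (A : lAlgType R) :=
  Order.Le_isPOrder.Build ring_display (LAlgebra.sort A)
    (@lalg_lexx R A) (@lalg_le_anti R A) (@lalg_le_trans R A).

HB.instance Definition _ (R : realType) (A : lAlgType R) :=
  Order.POrder_MeetJoin_isLattice.Build ring_display (LAlgebra.sort A)
    (@lalg_meetP R A) (@lalg_joinP R A).

HB.instance Definition _ (R : realType) (A : lAlgType R) :=
  GRing.Zmodule_isLmodule.Build R (LAlgebra.sort A)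
    (@lalg_scaleA R A) (@lalg_scale1 R A) (@lalg_scaleDr R A) (@lalg_scaleDl R A).

HB.instance Definition _ (R : realType) (A : lAlgType R) :=
  Num.POrderedZmodule.on (LAlgebra.sort A).

Definition bounded_lalg (R : realType) (A : lAlgType R) : Prop :=
  forall a : A, exists n : nat, - (n%:R : A) <= a /\ a <= n%:R.

Definition archimedean_lalg (R : realType) (A : lAlgType R) : Prop :=
  forall a b : A, (forall n : nat, a *+ n <= b) -> a <= 0.

Record balType (R : realType) := BalType {
  bal_lalg :> lAlgType R;
  bal_bounded : bounded_lalg bal_lalg;
  bal_archimedean : archimedean_lalg bal_lalg
}.

Section Norm.
Context {R : realType}.

Definition labs (A : lAlgType R) (a : A) : A := (a `|` - a)%O.

(* [inf] is 0 on sets without a finite infimum.  On a bounded l-algebra such as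
   C(X) with X compact, this only matters when 1 = 0. *)
Definition lnorm (A : lAlgType R) (a : A) : R :=
  inf [set r : R | labs a <= r *: (1 : A)].

Definition nclosure (A : lAlgType R) (S : set A) : set A :=
  [set a | forall e : R, 0 < e -> exists2 s, S s & lnorm (a - s) < e].

Definition rel_nclosure (A : lAlgType R) (P : A -> A -> Prop) (a b : A) : Prop :=
  forall e : R, 0 < e ->
    exists a' b', [/\ P a' b', lnorm (a - a') < e & lnorm (b - b') < e].

Definition ndense (A : lAlgType R) (S : set A) : Prop := nclosure S = setT.

Definition prec_of (A : lAlgType R) (S : set A) (a b : A) : Prop :=
  exists s, [/\ S s, a <= s & s <= b].

End Norm.

Section Proximity.
Context {R : realType}.

Record reflexive_proximity (A : balType R) (prec : A -> A -> Prop) : Prop := {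
  prox_le : forall a b : A, prec a b -> a <= b;
  prox_trans : forall a b c d : A, a <= b -> prec b c -> c <= d -> prec a d;
  prox_meet : forall a b c : A, prec a b -> prec a c -> prec a (b `&` c)%O;
  prox_join : forall a b c : A, prec a c -> prec b c -> prec (a `|` b)%O c;
  prox_interpolation : forall a b : A, prec a b ->
    exists c, [/\ prec a c, prec c c & prec c b];
  prox_add : forall a b c d : A, prec a b -> prec c d -> prec (a + c) (b + d);
  prox_mul : forall a b c d : A, 0 <= a -> 0 <= b -> 0 <= c -> 0 <= d ->
    prec a b -> prec c d -> prec (a * c) (b * d);
  prox_cst : forall r : R, prec (r *: (1 : A)) (r *: (1 : A));
  prox_scale : forall (a b : A) (r : R), 0 <= r -> prec a b ->
    prec (r *: a) (r *: b)
}.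

Definition reflexive_elts (A : balType R) (prec : A -> A -> Prop) : set A :=
  [set c | prec c c].

Record is_nbal (A : balType R) (prec : A -> A -> Prop) : Prop := {
  nbal_proximity : reflexive_proximity prec;
  nbal_dense : ndense
    [set c - d | c in reflexive_elts prec & d in reflexive_elts prec]
}.

End Proximity.

(* These structures are described on a subset S of a type T; S = setT gives the
   absolute notion.  The multiplication is only ever evaluated on the
   nonnegative elements of S. *)
Section Sbal.
Context {R : realType} {T : Type}.
Variables (S : set T) (le : T -> T -> Prop) (zero : T) (add join meet : T -> T -> T).

Record is_lmonoid : Prop := {
  lmon_zero : S zero;
  lmon_add : forall a b, S a -> S b -> S (add a b);
  lmon_join : forall a b, S a -> S b -> S (join a b);
  lmon_meet : forall a b, S a -> S b -> S (meet a b);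
  lmon_addA : forall a b c, S a -> S b -> S c ->
    add a (add b c) = add (add a b) c;
  lmon_addC : forall a b, S a -> S b -> add a b = add b a;
  lmon_add0 : forall a, S a -> add zero a = a;
  lmon_le_refl : forall a, S a -> le a a;
  lmon_le_anti : forall a b, S a -> S b -> le a b -> le b a -> a = b;
  lmon_le_trans : forall a b c, S a -> S b -> S c -> le a b -> le b c -> le a c;
  lmon_joinP : forall a b c, S a -> S b -> S c ->
    le (join a b) c <-> le a c /\ le b c;
  lmon_meetP : forall a b c, S a -> S b -> S c ->
    le c (meet a b) <-> le c a /\ le c b;
  lmon_leD : forall a b c, S a -> S b -> S c ->
    le a b <-> le (add a c) (add b c);
  lmon_joinD : forall a b c, S a -> S b -> S c ->
    add (join a b) c = join (add a c) (add b c);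
  lmon_meetD : forall a b c, S a -> S b -> S c ->
    add (meet a b) c = meet (add a c) (add b c)
}.

Definition nneg_part : set T := [set a | S a /\ le zero a].

Variables (one : T) (mul : T -> T -> T) (rho : R -> T).

Record is_lsemialgebra : Prop := {
  lsalg_lmonoid : is_lmonoid;
  lsalg_one : nneg_part one;
  lsalg_mul : forall a b, nneg_part a -> nneg_part b -> nneg_part (mul a b);
  lsalg_mulA : forall a b c, nneg_part a -> nneg_part b -> nneg_part c ->
    mul a (mul b c) = mul (mul a b) c;
  lsalg_mulC : forall a b, nneg_part a -> nneg_part b -> mul a b = mul b a;
  lsalg_mul1 : forall a, nneg_part a -> mul one a = a;
  lsalg_mulDr : forall a b c, nneg_part a -> nneg_part b -> nneg_part c ->
    mul a (add b c) = add (mul a b) (mul a c);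
  lsalg_le_mul : forall a b c, nneg_part a -> nneg_part b -> nneg_part c ->
    le a b -> le (mul a c) (mul b c);
  lsalg_rho : forall r, S (rho r);
  lsalg_rho1 : rho 1 = one;
  lsalg_rhoD : forall r s, rho (r + s) = add (rho r) (rho s);
  lsalg_rho_max : forall r s, rho (Num.max r s) = join (rho r) (rho s);
  lsalg_rho_min : forall r s, rho (Num.min r s) = meet (rho r) (rho s);
  lsalg_rhoM : forall r s, 0 <= r -> 0 <= s -> rho (r * s) = mul (rho r) (rho s)
}.

Let nmul (n : nat) (a : T) : T := iter n (add a) zero.

Record is_sbal : Prop := {
  sbal_lsemialgebra : is_lsemialgebra;
  sbal_bounded : forall a, S a ->
    exists r : R, [/\ 0 <= r, le (rho (- r)) a & le a (rho r)];
  sbal_archimedean : forall a b c d, S a -> S b -> S c -> S d ->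
    (forall n, le (add (nmul n a) b) (add (nmul n c) d)) -> le a c
}.

End Sbal.

(* S as a member of sbal for the operations and order of B, a real number r
   being sent to r.1 *)
Definition sub_sbal (R : realType) (B : lAlgType R) (S : set B) : Prop :=
  is_sbal S (fun f g => f <= g) 0 +%R (fun f g => f `|` g)%O
    (fun f g => f `&` g)%O 1 *%R (fun r : R => r *: (1 : B)).

Section ContinuousFunctions.
Context {R : realType} {X : topologicalType}.
Local Notation C := (continuousType X R).
Implicit Types f g h : C.

Lemma cts_add_subproof f g : continuous (fun x => f x + g x).
Proof. by move=> x; apply: cvgD; exact: cts_fun. Qed.
Definition cts_add f g : C := mkcts (@cts_add_subproof f g).

Lemma cts_opp_subproof f : continuous (fun x => - f x).
Proof. by move=> x; apply: cvgN; exact: cts_fun. Qed.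
Definition cts_opp f : C := mkcts (@cts_opp_subproof f).

Lemma cts_mul_subproof f g : continuous (fun x => f x * g x).
Proof. by move=> x; apply: cvgM; exact: cts_fun. Qed.
Definition cts_mul f g : C := mkcts (@cts_mul_subproof f g).

Lemma cts_scale_subproof (r : R) f : continuous (fun x => r * f x).
Proof. by move=> x; apply: cvgM; [exact: cvg_cst|exact: cts_fun]. Qed.
Definition cts_scale r f : C := mkcts (@cts_scale_subproof r f).

Lemma cts_max_subproof f g : continuous (fun x => Num.max (f x) (g x)).
Proof. by move=> x; apply: continuous_max; exact: cts_fun. Qed.
Definition cts_max f g : C := mkcts (@cts_max_subproof f g).

Lemma cts_min_subproof f g : continuous (fun x => Num.min (f x) (g x)).
Proof. by move=> x; apply: continuous_min; exact: cts_fun. Qed.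
Definition cts_min f g : C := mkcts (@cts_min_subproof f g).

Definition cts_cst (r : R) : C := @cst X R r.

Let eqC f g : (forall x, f x = g x) -> f = g.
Proof. by move=> fg; apply/continuousEP. Qed.

Lemma cts_addA : associative cts_add.
Proof. by move=> f g h; apply: eqC => x; exact: addrA. Qed.
Lemma cts_addC : commutative cts_add.
Proof. by move=> f g; apply: eqC => x; exact: addrC. Qed.
Lemma cts_add0 : left_id (cts_cst 0) cts_add.
Proof. by move=> f; apply: eqC => x; exact: add0r. Qed.
Lemma cts_addN : left_inverse (cts_cst 0) cts_opp cts_add.
Proof. by move=> f; apply: eqC => x; exact: addNr. Qed.

HB.instance Definition _ :=
  GRing.isZmodule.Build C cts_addA cts_addC cts_add0 cts_addN.

Lemma cts_mulA : associative cts_mul.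
Proof. by move=> f g h; apply: eqC => x; exact: mulrA. Qed.
Lemma cts_mulC : commutative cts_mul.
Proof. by move=> f g; apply: eqC => x; exact: mulrC. Qed.
Lemma cts_mul1 : left_id (cts_cst 1) cts_mul.
Proof. by move=> f; apply: eqC => x; exact: mul1r. Qed.
Lemma cts_mulDl : left_distributive cts_mul +%R.
Proof. by move=> f g h; apply: eqC => x; exact: mulrDl. Qed.

HB.instance Definition _ :=
  GRing.Zmodule_isComPzRing.Build C cts_mulA cts_mulC cts_mul1 cts_mulDl.

Lemma cts_scaleA r s f : cts_scale r (cts_scale s f) = cts_scale (r * s) f.
Proof. by apply: eqC => x; exact: mulrA. Qed.
Lemma cts_scale1 : left_id 1 cts_scale.
Proof. by move=> f; apply: eqC => x; exact: mul1r. Qed.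
Lemma cts_scaleDr : right_distributive cts_scale +%R.
Proof. by move=> r f g; apply: eqC => x; exact: mulrDr. Qed.
Lemma cts_scaleDl f : {morph cts_scale^~ f : r s / r + s}.
Proof. by move=> r s; apply: eqC => x; exact: mulrDl. Qed.

Definition cts_le f g : bool := `[< forall x, f x <= g x >].

Lemma cts_lexx : reflexive cts_le.
Proof. by move=> f; apply/asboolP => x. Qed.
Lemma cts_le_anti : antisymmetric cts_le.
Proof.
move=> f g /andP[/asboolP fg /asboolP gf]; apply: eqC => x.
by apply/eqP; rewrite eq_le fg gf.
Qed.
Lemma cts_le_trans : transitive cts_le.
Proof.
move=> g f h /asboolP fg /asboolP gh; apply/asboolP => x.
exact: le_trans (fg x) (gh x).
Qed.

Lemma cts_leP f g : reflect (forall x, f x <= g x) (cts_le f g).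
Proof. exact: asboolP. Qed.

Lemma cts_lexI f g h : cts_le f (cts_min g h) = cts_le f g && cts_le f h.
Proof.
apply/cts_leP/andP => [fgh|[/cts_leP fg /cts_leP fh] x].
  by split; apply/cts_leP => x; move: (fgh x); rewrite [X in _ <= X]/= le_min => /andP[].
by rewrite [X in _ <= X]/= le_min fg fh.
Qed.
Lemma cts_leUx f g h : cts_le (cts_max f g) h = cts_le f h && cts_le g h.
Proof.
apply/cts_leP/andP => [fgh|[/cts_leP fg /cts_leP fh] x].
  by split; apply/cts_leP => x; move: (fgh x); rewrite [X in X <= _]/= ge_max => /andP[].
by rewrite [X in X <= _]/= ge_max fg fh.
Qed.
Lemma cts_leD f g h : cts_le f g -> cts_le (f + h) (g + h).
Proof. by move=> /cts_leP fg; apply/cts_leP => x; apply: lerD (fg x) _. Qed.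
Lemma cts_mul_ge0 f g : cts_le 0 f -> cts_le 0 g -> cts_le 0 (f * g).
Proof.
by move=> /cts_leP f0 /cts_leP g0; apply/cts_leP => x; apply: mulr_ge0 (f0 x) (g0 x).
Qed.
Lemma cts_scaleAl r f g : cts_scale r (f * g) = cts_scale r f * g.
Proof. by apply: eqC => x; exact: mulrA. Qed.
Lemma cts_scale_ge0 r f : 0 <= r -> cts_le 0 f -> cts_le 0 (cts_scale r f).
Proof. by move=> r0 /cts_leP f0; apply/cts_leP => x; apply: mulr_ge0 r0 (f0 x). Qed.

HB.instance Definition _ := isLAlgebra.Build R C
  cts_lexx cts_le_anti cts_le_trans cts_lexI cts_leUx cts_leD cts_mul_ge0
  cts_scaleA cts_scale1 cts_scaleDr cts_scaleDl cts_scaleAl cts_scale_ge0.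

End ContinuousFunctions.

Section Ideals.
Context {R : realType} (A : lAlgType R).

Record is_lideal (I : set A) : Prop := {
  lideal0 : I 0;
  lidealD : forall a b, I a -> I b -> I (a + b);
  lidealM : forall r a, I a -> I (r * a);
  lideal_solid : forall a b, labs a <= labs b -> I b -> I a
}.

Record is_maximal_lideal (M : set A) : Prop := {
  maximal_lideal : is_lideal M;
  maximal_proper : M <> setT;
  maximal_max : forall I, is_lideal I -> I <> setT -> M `<=` I -> I = M
}.

End Ideals.

Section LAlgebraTheory.
Context {R : realType} {A : lAlgType R}.
Implicit Types (a b c : A) (r s : R) (I : set A).

Lemma lalg_lerD2r c a b : (a + c <= b + c) = (a <= b).
Proof.
apply/idP/idP => [|ab]; last exact: (@lalg_leD R A).
move=> h; have := @lalg_leD R A (a + c) (b + c) (- c) h.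
by rewrite !addrK.
Qed.

Lemma lalg_lerD a b c d : a <= b -> c <= d -> a + c <= b + d.
Proof.
move=> ab cd; apply: (@le_trans _ _ (b + c)); first by rewrite lalg_lerD2r.
by rewrite ![b + _]addrC lalg_lerD2r.
Qed.

Lemma lalg_subr_ge0 a b : (0 <= b - a) = (a <= b).
Proof. by rewrite -(lalg_lerD2r a 0) add0r subrK. Qed.

Lemma lalg_lerBlDr a b c : (a - b <= c) = (a <= c + b).
Proof. by rewrite -(lalg_lerD2r b (a - b)) subrK. Qed.

Lemma lalg_lerN2 a b : (- b <= - a) = (a <= b).
Proof. by rewrite -[LHS]lalg_subr_ge0 opprK addrC lalg_subr_ge0. Qed.

Lemma lalg_scaleAlE r a b : r *: (a * b) = (r *: a) * b.
Proof. exact: lalg_scaleAl. Qed.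

Lemma lalg_scaler_ge0 r a : 0 <= r -> 0 <= a -> 0 <= r *: a.
Proof. exact: lalg_scale_ge0. Qed.

Lemma lalg_mulr_ge0 a b : 0 <= a -> 0 <= b -> 0 <= a * b.
Proof. exact: lalg_mul_ge0. Qed.

Lemma lalg_lerZ r a b : 0 <= r -> a <= b -> r *: a <= r *: b.
Proof.
by move=> r0 ab; rewrite -lalg_subr_ge0 -scalerBr lalg_scaler_ge0// lalg_subr_ge0.
Qed.

Lemma lalg_lerZl r s a : 0 <= a -> r <= s -> r *: a <= s *: a.
Proof.
by move=> a0 rs; rewrite -lalg_subr_ge0 -scalerBl lalg_scaler_ge0// subr_ge0.
Qed.

Lemma ler_labs a : a <= labs a. Proof. exact: leUl. Qed.
Lemma lerN_labs a : - a <= labs a. Proof. exact: leUr. Qed.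

Lemma labs_le a c : a <= c -> - a <= c -> labs a <= c.
Proof. by move=> ac nac; rewrite leUx ac. Qed.

Lemma labsN a : labs (- a) = labs a.
Proof. by rewrite /labs opprK joinC. Qed.

Lemma lalg_half_ge0 a : 0 <= a + a -> 0 <= a.
Proof.
move=> aa; have -> : a = 2^-1 *: (a + a).
  by rewrite -[a in a + a]scale1r -scalerDl scalerA mulVf ?scale1r.
by apply: lalg_scaler_ge0 => //; rewrite invr_ge0.
Qed.

Lemma labs_ge0 a : 0 <= labs a.
Proof.
by apply: lalg_half_ge0; rewrite -(subrr a); apply: lalg_lerD; [exact: ler_labs|exact: lerN_labs].
Qed.

Lemma ger0_labs a : 0 <= a -> labs a = a.
Proof.
move=> a0; apply/le_anti; rewrite ler_labs andbT; apply: labs_le => //.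
by rewrite (le_trans _ a0)// -lalg_subr_ge0 opprK add0r.
Qed.

Lemma labs_id a : labs (labs a) = labs a.
Proof. by rewrite ger0_labs// labs_ge0. Qed.

Lemma labs0 : labs 0 = 0 :> A. Proof. exact: ger0_labs. Qed.

Lemma labs0_eq0 a : labs a <= 0 -> a = 0.
Proof.
move=> a0; apply/le_anti; rewrite (le_trans (ler_labs a) a0) /=.
by rewrite -lalg_lerN2 oppr0 (le_trans (lerN_labs a)).
Qed.

Lemma labsD a b : labs (a + b) <= labs a + labs b.
Proof.
apply: labs_le; first by apply: lalg_lerD; exact: ler_labs.
by rewrite opprD; apply: lalg_lerD; exact: lerN_labs.
Qed.

Lemma labsM a b : labs (a * b) <= labs a * labs b.
Proof.
have H (x y u v : A) : x <= u -> - x <= u -> y <= v -> - y <= v -> x * y <= u * v.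
  move=> xu xu' yv yv'; rewrite -lalg_subr_ge0; apply: lalg_half_ge0.
  have -> : (u * v - x * y) + (u * v - x * y) =
    (u - x) * (v + y) + (u + x) * (v - y) by ring.
  rewrite -[0](addr0 0); apply: lalg_lerD; apply: lalg_mulr_ge0.
  - by rewrite lalg_subr_ge0.
  - by rewrite -[y]opprK lalg_subr_ge0.
  - by rewrite -[x]opprK lalg_subr_ge0.
  - by rewrite lalg_subr_ge0.
apply: labs_le; last rewrite -mulNr; apply: H; rewrite ?opprK ?ler_labs ?lerN_labs //.
Qed.

Lemma lalg_joinD a b c : (a `|` b)%O + c = ((a + c) `|` (b + c))%O.
Proof.
apply/le_anti/andP; split; last by rewrite leUx !lalg_lerD2r leUl leUr.
by rewrite -[leRHS](subrK c) lalg_lerD2r leUx -![_ <= _ - c](lalg_lerD2r c) !subrK leUl leUr.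
Qed.

Lemma lalg_meetD a b c : (a `&` b)%O + c = ((a + c) `&` (b + c))%O.
Proof.
apply/le_anti/andP; split; first by rewrite lexI !lalg_lerD2r leIl leIr.
by rewrite -[leLHS](subrK c) lalg_lerD2r lexI !lalg_lerBlDr leIl leIr.
Qed.

Lemma lalg_oppU a b : - (a `|` b)%O = (- a `&` - b)%O.
Proof.
apply/le_anti/andP; split; first by rewrite lexI !lalg_lerN2 leUl leUr.
rewrite -[leLHS]opprK lalg_lerN2 leUx.
by apply/andP; split; rewrite -[leLHS]opprK lalg_lerN2 ?leIl ?leIr.
Qed.

Lemma lalg_pos_neg a : ((a `|` 0) `&` (- a `|` 0))%O = 0.
Proof.
have {1}-> : (a `|` 0)%O = a + (- a `|` 0)%O.
  by rewrite [RHS]addrC lalg_joinD addNr add0r joinC.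
rewrite -[X in (_ `&` X)%O]add0r -lalg_meetD.
by rewrite -[X in (X `&` _)%O]opprK -[X in (_ `&` X)%O]oppr0 -lalg_oppU addNr.
Qed.

Lemma lideal_labs I a : is_lideal I -> I (labs a) <-> I a.
Proof.
by move=> hI; split; apply: (lideal_solid hI); rewrite labs_id.
Qed.

Lemma lideal_le I a b : is_lideal I -> labs a <= b -> I b -> I a.
Proof.
move=> hI ab; apply: (lideal_solid hI); exact: le_trans ab (ler_labs b).
Qed.

Lemma lidealN I a : is_lideal I -> I a -> I (- a).
Proof. by move=> hI; apply: (lideal_solid hI); rewrite labsN. Qed.

Lemma lidealZ I r a : is_lideal I -> I a -> I (r *: a).
Proof.
by move=> hI; rewrite -[a in r *: a]mul1r lalg_scaleAlE; exact: lidealM.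
Qed.

Lemma lideal_setT : is_lideal (setT : set A).
Proof. by []. Qed.

Lemma lideal_set0 : is_lideal [set (0 : A)].
Proof.
split => //= [a b -> ->|r a ->|a b + b0]; rewrite ?addr0 ?mulr0//.
by rewrite b0 labs0 => /labs0_eq0.
Qed.

Lemma lideal_setI I J : is_lideal I -> is_lideal J -> is_lideal (I `&` J).
Proof.
move=> hI hJ; split.
- by split; exact: lideal0.
- by move=> a b [? ?] [? ?]; split; exact: lidealD.
- by move=> r a [? ?]; split; exact: lidealM.
- by move=> a b ab [? ?]; split; [exact: (lideal_solid hI) ab _|exact: (lideal_solid hJ) ab _].
Qed.

Definition lideal_gen (S : set A) : set A :=
  [set a | forall I, is_lideal I -> S `<=` I -> I a].

Lemma lideal_gen_lideal S : is_lideal (lideal_gen S).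
Proof.
split.
- by move=> I hI _; exact: lideal0.
- by move=> a b ha hb I hI SI; apply: (lidealD hI); [exact: ha|exact: hb].
- by move=> r a ha I hI SI; apply: (lidealM hI); exact: ha.
- by move=> a b ab hb I hI SI; apply: (lideal_solid hI) ab _; exact: hb.
Qed.

Lemma lideal_gen_sub S I : is_lideal I -> lideal_gen S `<=` I <-> S `<=` I.
Proof.
move=> hI; split => [SI a Sa|SI a]; last exact.
by apply: SI => J _; exact.
Qed.

End LAlgebraTheory.

Section Spectrum.
Context {R : realType} (A : balType R).

Record spectrum := Spectrum {
  spec_set :> set A;
  spec_maximal : is_maximal_lideal spec_set
}.

HB.instance Definition _ := gen_eqMixin spectrum.
HB.instance Definition _ := gen_choiceMixin spectrum.

Implicit Types (a b : A) (x : spectrum) (r s : R).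

Lemma spec_lideal x : is_lideal x.
Proof. exact: maximal_lideal (spec_maximal x). Qed.
Hint Resolve spec_lideal : core.

Lemma bal_le01 : 0 <= 1 :> A.
Proof.
have [n [n1 n2]] := @bal_bounded R A 1.
case: n n1 n2 => [|n] n1 n2; first by rewrite -[0]oppr0.
have : 0 <= n.+1%:R + n.+1%:R :> A.
  by rewrite -[X in _ + X]opprK lalg_subr_ge0 (le_trans n1).
move=> /lalg_half_ge0; rewrite -scaler_nat => /(lalg_scaler_ge0 (r := n.+1%:R^-1)).
by rewrite scalerA mulVf ?pnatr_eq0// scale1r; apply; rewrite invr_ge0.
Qed.

Lemma bal_le_scalar a : exists2 r : R, 0 <= r & labs a <= r *: (1 : A).
Proof.
have [n [n1 n2]] := @bal_bounded R A a.
exists n%:R => //; rewrite scaler_nat; apply: labs_le => //.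
by rewrite -lalg_lerN2 opprK.
Qed.

Lemma spec_proper x : ~ spec_set x 1.
Proof.
move=> x1; apply: (maximal_proper (spec_maximal x)); apply/seteqP; split => // a _.
by rewrite -[a]mulr1; exact: lidealM.
Qed.

Lemma spec_proper_scalar x r : spec_set x (r *: (1 : A)) -> r = 0.
Proof.
move=> xr; apply: contrapT => /eqP r0; apply: (@spec_proper x).
by rewrite -[1]scale1r -(mulVf r0) -scalerA; exact: lidealZ.
Qed.

Lemma spec_unit x a : 0 <= a -> ~ spec_set x a ->
  exists (m : A) (r : R), [/\ spec_set x m, 0 <= m, 0 <= r & (1 : A) <= m + r *: a].
Proof.
move=> a0 xa.
pose J := [set b | exists (m : A) (r : R), [/\ spec_set x m, 0 <= m, 0 <= r & labs b <= m + r *: a]].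
have hJ : is_lideal J.
  split.
  - exists 0, 0; split => //; first exact: lideal0.
    by rewrite labs0 scale0r addr0.
  - move=> b c [m [r [xm m0 r0 br]]] [m' [r' [xm' m'0 r'0 cr]]].
    exists (m + m'), (r + r'); split; [exact: lidealD| |exact: addr_ge0|].
      by rewrite -[0]addr0; exact: lalg_lerD.
    by rewrite scalerDl addrACA (le_trans (labsD _ _))//; exact: lalg_lerD.
  - move=> c b [m [r [xm m0 r0 br]]]; have [k k0 ck] := bal_le_scalar c.
    exists (k *: m), (k * r); split; [exact: lidealZ|exact: lalg_scaler_ge0|exact: mulr_ge0|].
    rewrite -scalerA -scalerDr (le_trans (labsM _ _))//.
    apply: (@le_trans _ _ (k *: labs b)); last exact: lalg_lerZ.
    rewrite -[labs b in leRHS]mul1r lalg_scaleAlE -lalg_subr_ge0 -mulrBl.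
    by rewrite lalg_mulr_ge0// ?labs_ge0// lalg_subr_ge0.
  - by move=> b c bc [m [r [xm m0 r0 br]]]; exists m, r; split => //; exact: le_trans br.
have xJ : x `<=` J.
  move=> m xm; exists (labs m), 0; split => //; [exact/lideal_labs|exact: labs_ge0|].
  by rewrite scale0r addr0.
have Ja : J a.
  by exists 0, 1; split => //; [exact: lideal0|rewrite add0r scale1r ger0_labs].
have [m [r [xm m0 r0]]] : J 1.
  apply: contrapT => J1; apply: xa.
  rewrite -(maximal_max (spec_maximal x) hJ) => // JT; apply: J1.
  by rewrite JT.
by rewrite ger0_labs ?bal_le01// => h; exists m, r.
Qed.

Lemma spec_prime x a b : 0 <= a -> 0 <= b -> spec_set x (a `&` b)%O -> spec_set x a \/ spec_set x b.
Proof.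
move=> a0 b0 xab; apply: contrapT => /not_orP[xa xb].
have [m [r [xm m0 r0 h]]] := spec_unit a0 xa.
have [m' [r' [xm' m'0 r'0 h']]] := spec_unit b0 xb.
pose M := m + m'; pose N := r + r' + 1.
have N0 : 0 < N by rewrite /N; lra.
have xM : spec_set x M by exact: lidealD.
have H (c : A) (k : R) : 0 <= c -> k <= N -> 1 - M <= k *: c -> N^-1 *: (1 - M) <= c.
  move=> c0 kN h0; rewrite -[c]scale1r -(mulVf (lt0r_neq0 N0)) -scalerA.
  apply: lalg_lerZ; first by rewrite invr_ge0 ltW.
  by rewrite (le_trans h0)//; exact: lalg_lerZl.
have Ha : N^-1 *: (1 - M) <= a.
  apply: (H _ r) => //; first by rewrite /N; lra.
  rewrite lalg_lerBlDr (le_trans h)// addrC; apply: lalg_lerD => //.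
  by rewrite -[leLHS]addr0; exact: lalg_lerD.
have Hb : N^-1 *: (1 - M) <= b.
  apply: (H _ r') => //; first by rewrite /N; lra.
  rewrite lalg_lerBlDr (le_trans h')// addrC; apply: lalg_lerD => //.
  by rewrite -[leLHS]add0r; exact: lalg_lerD.
have : N^-1 *: (1 - M) <= (a `&` b)%O by rewrite lexI Ha.
move=> /(lalg_lerZ (ltW N0)); rewrite scalerA mulfV ?scale1r; last exact: lt0r_neq0.
rewrite lalg_lerBlDr => h1; apply: (@spec_proper x).
apply: (@lideal_le _ _ _ _ (N *: (a `&` b)%O + M)) => //.
  by rewrite ger0_labs// bal_le01.
by apply: lidealD => //; exact: lidealZ.
Qed.

Definition spec_open : set_system spectrum :=
  [set U | exists2 I : set A, is_lideal I & U = ~` [set x : spectrum | I `<=` x]].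

Lemma spec_openT : spec_open setT.
Proof.
exists setT; first exact: lideal_setT.
apply/seteqP; split => // x _ Tx; apply: (@spec_proper x); exact: Tx.
Qed.

Lemma spec_openI : setI_closed spec_open.
Proof.
move=> _ _ [I hI ->] [J hJ ->]; exists (I `&` J); first exact: lideal_setI.
apply/seteqP; split => x /=; last by move=> h; split => h'; apply: h => a []; auto.
move=> [/existsNP[a /not_implyP[Ia xa]] /existsNP[b /not_implyP[Jb xb]]] h.
have ha := labs_ge0 a; have hb := labs_ge0 b.
have ab0 : 0 <= (labs a `&` labs b)%O by rewrite lexI ha.
case: (@spec_prime x (labs a) (labs b)) => //.
- apply: h; split.
    by apply: (lideal_le hI (b := labs a)); [rewrite ger0_labs// leIl|exact/lideal_labs].
  by apply: (lideal_le hJ (b := labs b)); [rewrite ger0_labs// leIr|exact/lideal_labs].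
- by move/(lideal_labs _ (spec_lideal x)).
- by move/(lideal_labs _ (spec_lideal x)).
Qed.

Lemma spec_open_bigU (T : Type) (f : T -> set spectrum) :
  (forall i, spec_open (f i)) -> spec_open (\bigcup_i f i).
Proof.
move=> fop; have /choice[J hJ] : forall i, exists I : set A,
    is_lideal I /\ f i = ~` [set x : spectrum | I `<=` x].
  by move=> i; have [I ? ?] := fop i; exists I.
exists (lideal_gen (\bigcup_i J i)); first exact: lideal_gen_lideal.
apply/seteqP; split => x /=.
  move=> [i _]; rewrite (hJ i).2 => /= h; rewrite lideal_gen_sub// => h'; apply: h.
  by move=> a Ja; apply: h'; exists i.
rewrite lideal_gen_sub// => h; apply: contrapT => h'; apply: h => a [i _ Ja].
apply: contrapT => xa; apply: h'; exists i => //; rewrite (hJ i).2 /=.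
by move=> /(_ a Ja).
Qed.

HB.instance Definition _ := isOpenTopological.Build spectrum
  spec_openT spec_openI spec_open_bigU.

Lemma spec_openE : open = spec_open :> set_system spectrum.
Proof. by []. Qed.

Lemma spec_open_notin a : open [set x : spectrum | ~ spec_set x a].
Proof.
rewrite spec_openE; exists (lideal_gen [set a]); first exact: lideal_gen_lideal.
apply/seteqP; split => x /=; rewrite lideal_gen_sub//.
  by move=> xa h; apply: xa; exact: h.
by move=> h xa; apply: h => _ ->.
Qed.

(* The residue of a in A/x, identified with R: a + x = r + x iff a - r is in x. *)
Definition phi_fun a (x : spectrum) : R := xget 0 [set r | spec_set x (a - r *: (1 : A))].

Let pos (a : A) : A := (a `|` 0)%O.

Let pos_ge0 a : 0 <= pos a. Proof. exact: leUr. Qed.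

Let spec_le x a b : 0 <= a -> a <= b -> spec_set x b -> spec_set x a.
Proof. by move=> a0 ab; apply: lideal_le => //; rewrite ger0_labs. Qed.

Lemma phi_exists a x : exists r, spec_set x (a - r *: (1 : A)).
Proof.
pose U := [set r : R | spec_set x (pos (a - r *: (1 : A)))].
have [k k0 ak] := bal_le_scalar a.
have U0 : U !=set0.
  exists k; rewrite /U /=; have -> : pos (a - k *: (1 : A)) = 0; last exact: lideal0.
  apply/le_anti; rewrite pos_ge0 andbT leUx lexx andbT lalg_lerBlDr add0r.
  exact: le_trans (ler_labs a) ak.
have Ulb : lbound U (- k).
  move=> r xr; rewrite leNgt; apply/negP => rk.
  suff /spec_proper_scalar : spec_set x ((- k - r) *: (1 : A)) by lra.
  apply: spec_le xr.
    by apply: lalg_scaler_ge0; [lra|exact: bal_le01].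
  apply: (@le_trans _ _ (a - r *: (1 : A))); last exact: leUl.
  rewrite scalerBl lalg_lerD2r scaleNr -[a]opprK lalg_lerN2.
  exact: le_trans (lerN_labs a) ak.
have hU : has_inf U by split => //; exists (- k).
pose r0 := inf U; exists r0; apply/(lideal_labs _ (spec_lideal x)).
have H e : 0 < e -> exists m : A,
    [/\ spec_set x m, 0 <= m & labs (a - r0 *: (1 : A)) <= e *: (1 : A) + m].
  move=> e0; have [r Ur rr] := inf_adherent e0 hU.
  pose b := a - (r0 - e) *: (1 : A).
  have xb : spec_set x (pos (- b)).
    have [] // := @spec_prime x (pos b) (pos (- b)) (pos_ge0 _) (pos_ge0 _).
      by rewrite lalg_pos_neg; exact: lideal0.
    by move=> Ub; have := ge_inf hU.2 Ub; rewrite -/r0; lra.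
  exists (pos (a - r *: (1 : A)) + pos (- b)); split.
  - exact: lidealD.
  - by rewrite -[0]addr0; exact: lalg_lerD.
  apply: labs_le.
    have -> : a - r0 *: (1 : A) = (r - r0) *: (1 : A) + (a - r *: (1 : A)).
      by rewrite scalerBl; move: (r *: _) (r0 *: _) => u v; ring.
    apply: lalg_lerD; first by apply: lalg_lerZl; [exact: bal_le01|rewrite /r0; lra].
    by rewrite -[leLHS]addr0; apply: lalg_lerD => //; exact: leUl.
  have -> : - (a - r0 *: (1 : A)) = e *: (1 : A) + - b.
    by rewrite /b scalerBl; move: (e *: _) (r0 *: _) => u v; ring.
  apply: lalg_lerD => //.
  by rewrite -[leLHS]add0r; apply: lalg_lerD => //; exact: leUl.
apply: contrapT => xl.
have [m [n [xm m0 n0 h]]] := spec_unit (labs_ge0 _) xl.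
have e0 : 0 < 2^-1 / (n + 1) :> R by apply: divr_gt0; lra.
have [m' [xm' m'0 h']] := H _ e0.
suff /spec_proper_scalar : spec_set x (2^-1 *: (1 : A)) by lra.
have xM : spec_set x (m + n *: m') by apply: lidealD => //; exact: lidealZ.
apply: spec_le xM; first by apply: lalg_scaler_ge0; [lra|exact: bal_le01].
have {1}-> : (2^-1 : R) = 1 - 2^-1 by lra.
rewrite scalerBl scale1r lalg_lerBlDr (le_trans h)// -addrA.
apply: lalg_lerD => //.
rewrite (le_trans (lalg_lerZ n0 h'))// scalerDr addrC; apply: lalg_lerD => //.
rewrite scalerA; apply: lalg_lerZl; first exact: bal_le01.
rewrite mulrCA ger_pMr; last lra.
by rewrite ler_pdivrMr; lra.
Qed.

Lemma phi_unique a x r s : spec_set x (a - r *: (1 : A)) -> spec_set x (a - s *: (1 : A)) -> r = s.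
Proof.
move=> xr xs; apply/eqP; rewrite -subr_eq0; apply/eqP.
apply: (@spec_proper_scalar x).
have -> : (r - s) *: (1 : A) = (a - s *: (1 : A)) - (a - r *: (1 : A)).
  by rewrite scalerBl; move: (r *: _) (s *: _) => u v; ring.
by apply: lidealD => //; exact: lidealN.
Qed.

Lemma phi_funP a x r : spec_set x (a - r *: (1 : A)) <-> phi_fun a x = r.
Proof.
have [s xs] := phi_exists a x.
have xp : spec_set x (a - phi_fun a x *: (1 : A)).
  by rewrite /phi_fun; case: xgetP => [? ->//|/(_ s)].
by split=> [xr|<-//]; exact: phi_unique xp xr.
Qed.

Lemma phi_fun_continuous a : continuous (phi_fun a).
Proof.
move=> x0; apply/(@cvgrPdist_lt _ R^o _ (nbhs x0) (nbhs_filter x0)) => e e0.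
pose r := phi_fun a x0.
have xr : spec_set x0 (a - r *: (1 : A)) by apply/phi_funP.
pose g := pos (e *: (1 : A) - labs (a - r *: (1 : A))).
have xg : ~ spec_set x0 g.
  move=> xg; suff /spec_proper_scalar : spec_set x0 (e *: (1 : A)) by lra.
  have xl : spec_set x0 (g + labs (a - r *: (1 : A))).
    by apply: lidealD => //; apply/lideal_labs.
  apply: spec_le xl; first by apply: lalg_scaler_ge0; [exact: ltW|exact: bal_le01].
  by rewrite -lalg_lerBlDr; exact: leUl.
have : nbhs x0 [set x : spectrum | ~ spec_set x g].
  by apply: open_nbhs_nbhs; split => //; exact: spec_open_notin.
apply: (@filterS _ (nbhs x0) (nbhs_filter x0)) => x /= xng; rewrite ltNge -/r; apply/negP => er; apply: xng.
pose s := phi_fun a x.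
have xs : spec_set x (a - s *: (1 : A)) by apply/phi_funP.
apply: (@spec_le x g (labs (a - s *: (1 : A)))); [exact: pos_ge0| |exact/lideal_labs].
rewrite leUx labs_ge0 andbT lalg_lerBlDr.
have le1 : e *: (1 : A) <= `|r - s| *: (1 : A) by apply: lalg_lerZl => //; exact: bal_le01.
apply: (le_trans le1).
have le2 : `|r - s| *: (1 : A) <= labs ((r - s) *: (1 : A)).
  have [rs|rs] := leP 0 (r - s); first by rewrite ger0_norm// ler_labs.
  by rewrite ltr0_norm// scaleNr lerN_labs.
apply: (le_trans le2).
have -> : (r - s) *: (1 : A) = (a - s *: (1 : A)) + - (a - r *: (1 : A)).
  by rewrite scalerBl; move: (r *: _) (s *: _) => u v; ring.
by rewrite (le_trans (labsD _ _))// labsN.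
Qed.

Definition phi a : continuousType spectrum R := mkcts (@phi_fun_continuous a).

(* The relation carried by the image of A once A is identified with it. *)
Definition phi_rel (prec : A -> A -> Prop)
    (f g : continuousType spectrum R) : Prop :=
  exists a b, [/\ prec a b, f = phi a & g = phi b].

End Spectrum.

(* Main.v *)
(* The spectrum is compact and phi is a homomorphism of l-algebras, whose image
   is dense in C(X_A) by the lattice form of the Stone-Weierstrass theorem.  On
   C(X_A) uniform closeness is then pointwise, so S inherits the closure
   properties of the reflexive elements.
   If f <= s <= g with s in S, approximate f, s, g by a, c, b with c reflexive:
   then a `&` c is proximal to b `|` c, and these approximate f and g.
   Conversely, if (f, g) is a limit of pairs in the proximity, there are
   reflexive elements c_n which are between f and g up to 2^-n.  They need not
   converge, but clamping c_(n+1) between s_n - 2^-n and s_n + 2^-n gives a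
   uniformly Cauchy sequence s_n with the same property. *)

Require Import Defs.
From mathcomp Require Import all_boot all_order all_algebra.
From mathcomp Require Import all_classical all_reals all_analysis.
From mathcomp Require Import ring lra.

Set Implicit Arguments.
Unset Strict Implicit.
Unset Printing Implicit Defensive.

Import Order.TTheory GRing.Theory Num.Theory.
Import numFieldNormedType.Exports.

Local Open Scope classical_set_scope.
Local Open Scope ring_scope.

(** * The embedding [phi] as a homomorphism of l-algebras, and the spectrum as a compact space *)

Section PhiMorphism.
Context {R : realType} {A : balType R}.
Implicit Types (a b : A) (x y : spectrum A) (r s : R).

Lemma phi_spec a x : spec_set x (a - phi a x *: (1 : A)).
Proof. exact/phi_funP. Qed.

Lemma phi_eq0 a x : spec_set x a <-> phi a x = 0.
Proof. by rewrite -{1}[a]subr0 -(scale0r (1 : A)); exact: phi_funP. Qed.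

Lemma phi_scalar r x : phi (r *: (1 : A)) x = r.
Proof. by apply/phi_funP; rewrite subrr; exact: lideal0 (spec_lideal x). Qed.

Lemma phiD a b x : phi (a + b) x = phi a x + phi b x.
Proof.
apply/phi_funP; rewrite scalerDl opprD addrACA.
by apply: (lidealD (spec_lideal x)); exact: phi_spec.
Qed.

Lemma phiM a b x : phi (a * b) x = phi a x * phi b x.
Proof.
have hx := spec_lideal x; have := phi_spec a x; have := phi_spec b x.
move: (phi a x) (phi b x) => r s bs ar; apply/phi_funP.
have -> : a * b - (r * s) *: (1 : A) =
    a * (b - s *: (1 : A)) + (s *: (1 : A)) * (a - r *: (1 : A)).
  have -> : (r * s) *: (1 : A) = (s *: (1 : A)) * (r *: (1 : A)).
    by rewrite -lalg_scaleAlE mul1r scalerA mulrC.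
  by move: (s *: (1 : A)) (r *: (1 : A)) => u v; ring.
by apply: (lidealD hx); exact: (lidealM hx).
Qed.

Lemma phiZ r a x : phi (r *: a) x = r * phi a x.
Proof. by rewrite -[a in LHS]mul1r lalg_scaleAlE phiM phi_scalar. Qed.

Lemma phiN a x : phi (- a) x = - phi a x.
Proof. by rewrite -scaleN1r phiZ mulN1r. Qed.

(** The distances of a and b to their residues r and s lie in x, and so does their sum [u]. The join
    of a and b differs from the maximum of r and s by at most [u] in absolute value, so solidity of
    x applies. *)
Lemma phiU a b x : phi (a `|` b)%O x = Num.max (phi a x) (phi b x).
Proof.
apply/phi_funP.
pose r := phi a x; pose s := phi b x; rewrite -/r -/s.
pose u := labs (a - r *: (1 : A)) + labs (b - s *: (1 : A)).
have hx := spec_lideal x.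
have xu : spec_set x u.
  by apply: (lidealD hx); apply/(lideal_labs _ hx); exact: phi_spec.
apply: (lideal_le hx) xu.
have au : labs (a - r *: (1 : A)) <= u.
  by rewrite -[leLHS]addr0 lalg_lerD// labs_ge0.
have bu : labs (b - s *: (1 : A)) <= u.
  by rewrite -[leLHS]add0r lalg_lerD// labs_ge0.
apply: labs_le.
  rewrite lalg_lerBlDr leUx; apply/andP; split; rewrite -lalg_lerBlDr.
    apply: le_trans (le_trans (ler_labs _) au).
    rewrite addrC [leRHS]addrC lalg_lerD2r lalg_lerN2 lalg_lerZl ?bal_le01//.
    by rewrite le_max lexx.
  apply: le_trans (le_trans (ler_labs _) bu).
  rewrite addrC [leRHS]addrC lalg_lerD2r lalg_lerN2 lalg_lerZl ?bal_le01//.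
  by rewrite le_max lexx orbT.
rewrite opprB lalg_lerBlDr; have [_|_] := leP r s.
  rewrite -[leLHS](subrK b); apply: lalg_lerD; last exact: leUr.
  by rewrite -opprB; exact: le_trans (lerN_labs _) bu.
rewrite -[leLHS](subrK a); apply: lalg_lerD; last exact: leUl.
by rewrite -opprB; exact: le_trans (lerN_labs _) au.
Qed.

Lemma phiI a b x : phi (a `&` b)%O x = Num.min (phi a x) (phi b x).
Proof.
rewrite -[a in LHS]opprK -[b in LHS]opprK -lalg_oppU phiN phiU !phiN.
by rewrite -oppr_min opprK.
Qed.

Lemma phi_labs a x : phi (labs a) x = `|phi a x|.
Proof. by rewrite phiU phiN maxrN. Qed.

Lemma phi_le a b x : a <= b -> phi a x <= phi b x.
Proof. by move=> /join_idPl; rewrite joinC => <-; rewrite phiU le_max lexx. Qed.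

Lemma phi_bounded a : exists2 k, 0 <= k & forall x, `|phi a x| <= k.
Proof.
have [k k0 ak] := bal_le_scalar a; exists k => // x.
by rewrite -phi_labs -[leRHS](phi_scalar k x); exact: phi_le.
Qed.

Lemma spec_eq x y : spec_set x `<=` spec_set y -> x = y.
Proof.
move=> xy; have : spec_set y = spec_set x.
  exact: (maximal_max (spec_maximal x) (spec_lideal y) (maximal_proper (spec_maximal y))).
case: x y {xy} => [x hx] [y hy] /= exy; subst y.
by rewrite (Prop_irrelevance hx hy).
Qed.

(** Distinct maximal ideals are not nested, so some b lies in x but not in y: [phi b] vanishes at x
    and not at y, and an affine expression in b takes any two prescribed values. *)
Lemma phi_separates x y r s : x <> y ->
  exists a, phi a x = r /\ phi a y = s.
Proof.
move=> xy; have [b [xb yb]] : exists b, spec_set x b /\ ~ spec_set y b.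
  apply: contrapT => h; apply: xy; apply: spec_eq => b xb.
  by apply: contrapT => yb; apply: h; exists b.
exists (r *: (1 : A) + ((s - r) / phi b y) *: b); rewrite !phiD !phi_scalar !phiZ.
have -> : phi b x = 0 by apply/phi_eq0.
have b0 : phi b y != 0 by apply/eqP => /phi_eq0.
by rewrite mulr0 addr0 divfK// addrC subrK.
Qed.

Definition ultra_ideal (F : set_system (spectrum A)) : set A :=
  [set a | forall e : R, 0 < e -> F [set x | `|phi a x| < e]].

(** Each [phi a] is bounded and so converges along F to some r, which makes a congruent to r modulo
    [ultra_ideal F]. An ideal containing [ultra_ideal F] and an element with nonzero limit therefore
    contains a nonzero scalar, hence everything. *)
Lemma ultra_ideal_maximal (F : set_system (spectrum A)) :
  UltraFilter F -> is_maximal_lideal (ultra_ideal F).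
Proof.
move=> FU; have FF : ProperFilter F by exact: ultra_proper.
have FlI : is_lideal (ultra_ideal F).
  split.
  - move=> e e0; apply: filterS (@filterT _ F _) => x _ /=.
    by rewrite -(scale0r (1 : A)) phi_scalar normr0.
  - move=> a b Fa Fb e e0; have e20 : 0 < e / 2 by rewrite divr_gt0.
    apply: filterS (filterI (Fa _ e20) (Fb _ e20)) => x /= [xa xb].
    by rewrite phiD (le_lt_trans (ler_normD _ _))//; lra.
  - move=> b a Fa e e0; have [k k0 bk] := phi_bounded b.
    have ek : 0 < e / (k + 1) by apply: divr_gt0 => //; lra.
    apply: filterS (Fa _ ek) => x /= xa; rewrite phiM normrM.
    rewrite ltr_pdivlMr in xa; last lra.
    by apply: le_lt_trans xa; rewrite mulrC ler_wpM2l// (le_trans (bk x))//; lra.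
  - move=> a b ab Fb e e0; apply: filterS (Fb _ e0) => x /=.
    by apply: le_lt_trans; rewrite -!phi_labs; exact: phi_le.
have Flim a : exists r : R, ultra_ideal F (a - r *: (1 : A)).
  have [k k0 ak] := phi_bounded a.
  have FG : ProperFilter (phi a @ F) by exact: fmap_proper_filter.
  have [|r [_ clr]] := @segment_compact R (- k) k (phi a @ F) FG.
    apply: (@filterS _ F _ setT) (@filterT _ F _) => x _ /=.
    by rewrite in_itv /= -ler_norml; exact: ak.
  exists r => e e0; pose U := [set x : spectrum A | `|phi a x - r| < e].
  have -> : [set x | `|phi (a - r *: (1 : A)) x| < e] = U.
    by apply/seteqP; split => x; rewrite /U /= phiD phiN phi_scalar.
  (* If F contained the complement of [U], then [phi a] would stay at distance at least e from its
     cluster point r. *)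
  have [//|FU'] := in_ultra_setVsetC U FU.
  have [] := clr [set t | ~ `|t - r| < e] (ball r e).
  - exact: FU'.
  - exact: nbhsx_ballx.
  - by move=> t [/= te]; rewrite /ball /= distrC.
split => //.
  move=> FT; have : ultra_ideal F 1 by rewrite FT.
  move=> /(_ _ ltr01) /filter_ex[x /=].
  by rewrite -(scale1r (1 : A)) phi_scalar normr1 ltxx.
move=> I hI IT FI; apply/seteqP; split => // a Ia.
have [r Fr] := Flim a; have Ir : I (r *: (1 : A)).
  have -> : r *: (1 : A) = a - (a - r *: (1 : A)) by rewrite opprB addrC subrK.
  by apply: (lidealD hI) => //; apply: (lidealN hI); exact: FI.
have [r0|/eqP r0] := eqVneq r 0; first by rewrite r0 scale0r subr0 in Fr.
exfalso; apply: IT; apply/seteqP; split => // b _.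
rewrite -[b]mulr1; apply: (lidealM hI).
rewrite -[1]scale1r -(mulVf (x := r)) -?scalerA; last exact/eqP.
exact: lidealZ.
Qed.

(* The limit of an ultrafilter F is the ideal of those a with phi a -> 0 along F. *)
Lemma spectrum_compact : compact [set: spectrum A].
Proof.
rewrite compact_ultra => F FU _; pose y := Spectrum (ultra_ideal_maximal FU).
exists y; split => // U; rewrite nbhsE => -[V [oV yV] VU].
apply: filterS VU _; move: oV; rewrite spec_openE => -[I hI VE].
move: yV; rewrite VE => /= /existsNP[a /not_implyP[Ia]].
rewrite /ultra_ideal /= => /existsNP[e /not_implyP[e0 nF]].
(* Since [phi a] does not tend to 0, F contains a set on which it stays away from 0; no point of
   that set contains a, let alone I. *)
have [//|Fa] := in_ultra_setVsetC [set x | `|phi a x| < e] FU.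
apply: filterS Fa => x /= xe Ix; apply: xe.
by have /phi_eq0 -> := Ix _ Ia; rewrite normr0.
Qed.

End PhiMorphism.

(* Otherwise the sets U with P (~` U) form a proper filter without cluster points. *)
Lemma compact_set_ind (T : topologicalType) (P : set T -> Prop) :
  compact [set: T] -> P set0 ->
  (forall U V, V `<=` U -> P U -> P V) ->
  (forall U V, P U -> P V -> P (U `|` V)) ->
  (forall x : T, exists2 U, nbhs x U & P U) -> P setT.
Proof.
move=> cT P0 Psub PU Ploc; apply: contrapT => nPT.
pose F : set_system T := [set U | P (~` U)].
have FF : ProperFilter F.
  apply: Build_ProperFilter_ex.
    move=> U FU; apply/set0P/negP => /eqP U0; apply: nPT.
    by move: FU; rewrite /F /= U0 setC0.
  split; rewrite /F /=.
  - by rewrite setCT.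
  - by move=> U V; rewrite /= setCI; exact: PU.
  - by move=> U V UV; apply: Psub; exact: subsetC.
have [|x [_ clx]] := cT F FF; first by rewrite /F /= setCT.
have [U Ux PUU] := Ploc x.
have [] := clx (~` U) U _ Ux; first by rewrite /F /= setCK.
by move=> y [].
Qed.

(** * The uniform norm and closures in C(X) for X compact, in pointwise terms *)

Section Continuous.
Context {R : realType} {X : topologicalType}.
Implicit Types f g : continuousType X R.

Lemma cts_near f x (e : R) : 0 < e -> nbhs x [set y | `|f y - f x| < e].
Proof.
move=> e0; have /cvgrPdist_lt/(_ _ e0) := @cts_fun _ _ f x.
by apply: filterS => y /=; rewrite distrC.
Qed.

Local Notation C := (continuousType X R : lAlgType R).

Lemma cts_leE f g : ((f : C) <= g) <-> forall x, f x <= g x.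
Proof. by split => [/cts_leP|h]; [|exact/cts_leP]. Qed.

Lemma cts_bounded f : compact [set: X] ->
  exists2 k, 0 <= k & forall x, `|f x| <= k.
Proof.
move=> cX; pose P (U : set X) := exists2 k, 0 <= k & forall x, U x -> `|f x| <= k.
suff [k k0 fk] : P setT by exists k => // x; exact: fk.
apply: compact_set_ind => //.
- by exists 0.
- by move=> U V VU [k k0 fk]; exists k => // x /VU; exact: fk.
- move=> U V [k k0 fk] [l l0 fl]; exists (k + l); first exact: addr_ge0.
  by move=> x [/fk|/fl]; lra.
- move=> x; exists [set y | `|f y - f x| < 1]; first exact: cts_near.
  exists (`|f x| + 1) => [|y /=]; first by rewrite addr_ge0.
  by move=> fxy; have := ler_normD (f y - f x) (f x); rewrite subrK; lra.
Qed.

Lemma cts_labs f x : labs f x = `|f x|.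
Proof. exact: maxrN. Qed.

(* For X compact the set whose infimum is the norm is nonempty, and it is
   bounded below unless X is empty, in which case the norm is 0. *)
Lemma lnorm_lt f (e : R) : compact [set: X] -> 0 < e ->
  lnorm f < e <-> exists2 r, r < e & forall x, `|f x| <= r.
Proof.
move=> cX e0; rewrite /lnorm; set E := [set r | _].
have EP r : E r <-> forall x, `|f x| <= r.
  rewrite /E /= cts_leE; split => h x; have := h x; rewrite cts_labs.
    by move=> /le_trans; apply; rewrite [leLHS]mulr1.
  by move=> /le_trans; apply; rewrite [leRHS]mulr1.
split => [fe|[r re fr]].
  have [k _ fk] := cts_bounded f cX.
  have [|r Er re] := @inf_lt _ E e _ fe; first by exists k; exact/EP.
  by exists r => //; exact/EP.
have [[x _]|X0] := pselect ([set: X] !=set0).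
  apply: le_lt_trans re; apply: ge_inf; last exact/EP.
  by exists 0 => s /EP /(_ x); exact: le_trans.
rewrite inf_out// => -[_ [l El]].
have : E (l - 1) by apply/EP => x; case: X0; exists x.
by move=> /El; lra.
Qed.

Lemma nclosureP (S : set (continuousType X R)) f : compact [set: X] ->
  nclosure S f <->
  forall e : R, 0 < e -> exists2 s, S s & forall x, `|f x - s x| < e.
Proof.
move=> cX; split => h e e0.
  have [s Ss] := h _ e0; move=> /(lnorm_lt _ cX e0)[r re fr]; exists s => // x.
  exact: le_lt_trans (fr x) re.
(* A strict pointwise bound by e only gives norm at most e; halving restores strictness. *)
have e20 : 0 < e / 2 by rewrite divr_gt0.
have [s Ss fs] := h _ e20; exists s => //; apply/(lnorm_lt _ cX e0).
by exists (e / 2) => [|x]; [lra|exact/ltW/fs].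
Qed.

Lemma rel_nclosureP (P : continuousType X R -> continuousType X R -> Prop) f g :
  compact [set: X] -> rel_nclosure P f g <->
  forall e : R, 0 < e -> exists f' g', [/\ P f' g',
    forall x, `|f x - f' x| < e & forall x, `|g x - g' x| < e].
Proof.
move=> cX; split => h e e0.
  have [f' [g' [Pfg]]] := h _ e0.
  move=> /(lnorm_lt _ cX e0)[r re fr] /(lnorm_lt _ cX e0)[s se gs].
  exists f', g'; split => // x; first exact: le_lt_trans (fr x) re.
  exact: le_lt_trans (gs x) se.
have e20 : 0 < e / 2 by rewrite divr_gt0.
have [f' [g' [Pfg ff gg]]] := h _ e20; exists f', g'; split => //.
  by apply/(lnorm_lt _ cX e0); exists (e / 2) => [|x]; [lra|exact/ltW/ff].
by apply/(lnorm_lt _ cX e0); exists (e / 2) => [|x]; [lra|exact/ltW/gg].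
Qed.

End Continuous.

(** * Uniform limits and uniform approximation of continuous functions *)

Lemma geometric_limit {R : realType} (u : nat -> R) :
  (forall n, `|u n.+1 - u n| <= 2^-1 ^+ n) ->
  exists l, forall n, `|u n - l| <= 2 * 2^-1 ^+ n.
Proof.
(* The geometric series from index n on sums to 2 * 2^-n, so the intervals from [v n] to [w n] are
   nested; the limit is a point common to all of them. *)
move=> uS; pose v n := u n - 2 * 2^-1 ^+ n; pose w n := u n + 2 * 2^-1 ^+ n.
have vS n : v n <= v n.+1.
  by have := uS n; rewrite ler_norml /v exprS => /andP[]; lra.
have wS n : w n.+1 <= w n.
  by have := uS n; rewrite ler_norml /w exprS => /andP[]; lra.
have vw m n : v m <= w n.
  have p0 k : 0 <= 2^-1 ^+ k :> R by rewrite exprn_ge0// invr_ge0.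
  apply: (@le_trans _ _ (v (maxn m n))).
    by apply: (homo_leq le_refl (fun _ _ _ => @le_trans _ _ _ _ _) vS); rewrite leq_maxl.
  apply: (@le_trans _ _ (w (maxn m n))); first by rewrite /v /w; have := p0 (maxn m n); lra.
  have : {homo w : i j / (i <= j)%N >-> j <= i}.
    by apply: homo_leq => // x y z xy yz; exact: le_trans yz xy.
  by apply; rewrite leq_maxr.
have hv : has_ubound (range v) by exists (w 0%N) => _ [m _ <-].
exists (sup (range v)) => n; rewrite ler_norml.
have h1 : v n <= sup (range v) by apply: ub_le_sup => //; exists n.
have h2 : sup (range v) <= w n.
  by apply: ge_sup; [exists (v 0%N), 0%N|move=> _ [m _ <-]].
by move: h1 h2; rewrite /v /w; lra.
Qed.

Lemma half_pow_lt {R : realType} (e : R) : 0 < e -> exists n, 2^-1 ^+ n < e.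
Proof.
move=> e0; have h : (fun n => 2^-1 ^+ n : R) @ \oo --> (0 : R).
  by apply: cvg_expr; rewrite ger0_norm; lra.
move/cvgrPdist_lt : h => /(_ _ e0)[n _ /(_ n (leqnn n))] /=.
by rewrite sub0r normrN ger0_norm ?exprn_ge0 ?invr_ge0//; exists n.
Qed.

Lemma uniform_geometric_limit {R : realType} {X : topologicalType}
    (s : nat -> continuousType X R) :
  (forall n x, `|s n.+1 x - s n x| <= 2^-1 ^+ n) ->
  exists l : continuousType X R, forall n x, `|s n x - l x| <= 2 * 2^-1 ^+ n.
Proof.
move=> sS; have /choice[l sl] : forall x, exists r : R,
    forall n, `|s n x - r| <= 2 * 2^-1 ^+ n.
  by move=> x; apply: geometric_limit => n; exact: sS.
suff lc : continuous l by exists (mkcts lc) => n x; exact: sl.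
move=> x; apply/cvgrPdist_lt => e e0.
(* Two passages between [l] and [s n] cost 2e/5 each, and the variation of [s n] costs e/5. *)
have e50 : 0 < e / 5 by rewrite divr_gt0.
have [n ne] := half_pow_lt e50.
apply: filterS (cts_near (s n) x e50) => y /= sxy.
have := sl x n; have := sl y n; move: sxy.
by rewrite ltr_norml !ler_norml ltr_norml => /andP[? ?] /andP[? ?] /andP[? ?]; apply/andP; split; lra.
Qed.

(** Stone-Weierstrass for lattices: two-point interpolants of f are joined over a finite cover to
    get above f - e while keeping the value of f at x; then finitely many of these are met to get
    below f + e as well. *)
Lemma phi_dense {R : realType} {A : balType R} (f : continuousType (spectrum A) R)
    (e : R) : 0 < e -> exists a, forall x, `|f x - phi a x| < e.
Proof.
move=> e0; have e20 : 0 < e / 2 by rewrite divr_gt0.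
have interp x y : exists a : A, phi a x = f x /\ phi a y = f y.
  have [->|xy] := pselect (x = y); last exact: phi_separates.
  by exists (f y *: (1 : A)); rewrite phi_scalar.
have cX := @spectrum_compact R A.
have above x : exists a, phi a x = f x /\ forall y, f y - e < phi a y.
  pose P (U : set (spectrum A)) := exists a, phi a x = f x /\
    forall y, U y -> f y - e < phi a y.
  suff [a [ax fa]] : P setT by exists a; split => // y; exact: fa.
  apply: compact_set_ind => //.
  - by have [a []] := interp x x; exists a.
  - by move=> U V VU [a [ax fa]]; exists a; split => // y /VU; exact: fa.
  - move=> U V [a [ax fa]] [b [bx fb]]; exists (a `|` b)%O.
    rewrite phiU ax bx maxxx; split => // y; rewrite phiU lt_max.
    by move=> [/fa ->|/fb ->]; rewrite ?orbT.
  - move=> y; have [a [ax ay]] := interp x y.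
    (* As [phi a] and f agree at y, they differ by less than e on this neighbourhood. *)
    exists ([set z | `|f z - f y| < e / 2] `&` [set z | `|phi a z - phi a y| < e / 2]).
      by apply: filterI; exact: cts_near.
    exists a; split => // z [/=]; rewrite ay !ltr_norml => /andP[? ?] /andP[? ?].
    by lra.
pose Q (U : set (spectrum A)) := exists a, (forall y, f y - e < phi a y) /\
  forall y, U y -> phi a y < f y + e.
suff [a [fa af]] : Q setT.
  by exists a => x; rewrite ltr_norml; have := fa x; have := af x Logic.I; lra.
apply: compact_set_ind => //.
(* Even over the empty set an element above f - e is required; a constant bounding f serves. *)
- have [k k0 fk] := cts_bounded f cX; exists (k *: (1 : A)); split => // y.
  by rewrite phi_scalar; have := fk y; rewrite ler_norml; lra.
- by move=> U V VU [a [fa af]]; exists a; split => // y /VU; exact: af.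
- move=> U V [a [fa af]] [b [fb bf]]; exists (a `&` b)%O.
  split => y; rewrite phiI; first by rewrite lt_min fa fb.
  by rewrite gt_min => -[/af ->|/bf ->]; rewrite ?orbT.
- move=> y; have [a [ay fa]] := above y.
  exists ([set z | `|f z - f y| < e / 2] `&` [set z | `|phi a z - phi a y| < e / 2]).
    by apply: filterI; exact: cts_near.
  exists a; split => // z [/=]; rewrite ay !ltr_norml => /andP[? ?] /andP[? ?].
  by lra.
Qed.

(** * Subsets of a bounded archimedean l-algebra that belong to sbal *)

Section SubSbal.
Context {R : realType} {B : balType R}.
Variable S : set B.

(** The order, the algebraic laws, boundedness and the archimedean property are inherited from B, so
    only closure under the operations concerns S. *)
Lemma sub_sbal_closed :
  (forall r : R, S (r *: (1 : B))) ->
  (forall a b, S a -> S b -> S (a + b)) ->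
  (forall a b, S a -> S b -> S (a `|` b)%O) ->
  (forall a b, S a -> S b -> S (a `&` b)%O) ->
  (forall a b, S a -> S b -> 0 <= a -> 0 <= b -> S (a * b)) ->
  sub_sbal S.
Proof.
move=> SZ SD SU SI SM.
have S0 : S 0 by rewrite -(scale0r (1 : B)).
have S1 : S 1 by rewrite -(scale1r (1 : B)).
have iterE n (a : B) : iter n (+%R a) 0 = a *+ n.
  by elim: n => //= n ->; rewrite mulrS.
split; last first.
(* The hypothesis rearranges to n(a - c) <= d - b for all n, to which the archimedean property of B
   applies. *)
- move=> a b c d _ _ _ _ h; rewrite -lalg_subr_ge0 -opprB -oppr0 lalg_lerN2.
  apply: (@bal_archimedean R B _ (d - b)) => n.
  have := h n; rewrite !iterE => h'.
  rewrite mulrnBl lalg_lerBlDr -(lalg_lerD2r b).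
  by rewrite (le_trans h')// addrAC subrK addrC.
- move=> a _; have [k k0 ak] := bal_le_scalar a; exists k; split => //.
    by rewrite scaleNr -[a]opprK lalg_lerN2 (le_trans (lerN_labs a)).
  exact: le_trans (ler_labs a) ak.
split => //.
- split => //.
  + by move=> a b c _ _ _; rewrite addrA.
  + by move=> a b _ _; rewrite addrC.
  + by move=> a _; rewrite add0r.
  + by move=> a b _ _ ab ba; apply/le_anti; rewrite ab ba.
  + by move=> a b c _ _ _; exact: le_trans.
  + by move=> a b c _ _ _; rewrite leUx; split => /andP.
  + by move=> a b c _ _ _; rewrite lexI; split => /andP.
  + by move=> a b c _ _ _; rewrite lalg_lerD2r.
  + by move=> a b c _ _ _; exact: lalg_joinD.
  + by move=> a b c _ _ _; exact: lalg_meetD.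
- by split => //; exact: bal_le01.
- by move=> a b [Sa a0] [Sb b0]; split; [exact: SM|exact: lalg_mulr_ge0].
- by move=> a b c _ _ _; rewrite mulrA.
- by move=> a b _ _; rewrite mulrC.
- by move=> a _; rewrite mul1r.
- by move=> a b c _ _ _; rewrite mulrDr.
- move=> a b c _ _ [_ c0] ab; rewrite -lalg_subr_ge0 -mulrBl.
  by apply: lalg_mulr_ge0 => //; rewrite lalg_subr_ge0.
- by rewrite scale1r.
- by move=> r s; rewrite scalerDl.
- move=> r s; have h := lalg_lerZl (@bal_le01 R B).
  have [rs|/ltW rs] := leP r s; first by apply/esym/join_idPr; exact: h.
  by apply/esym/join_idPl; exact: h.
- move=> r s; have h := lalg_lerZl (@bal_le01 R B).
  have [rs|/ltW rs] := leP r s; first by apply/esym/meet_idPl; exact: h.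
  by apply/esym/meet_idPr; exact: h.
- by move=> r s _ _; rewrite -lalg_scaleAlE mul1r scalerA.
Qed.

End SubSbal.

(** * C(X) as a bounded archimedean l-algebra, for X compact *)

Section CompactBal.
Context {R : realType} {X : topologicalType}.
Hypothesis cX : compact [set: X].
Local Notation C := (continuousType X R : lAlgType R).

Lemma cts_mulrn (f : continuousType X R) n x : (f *+ n : C) x = f x *+ n.
Proof. by elim: n => // n IH; rewrite !mulrS -IH. Qed.

Lemma cts_natr n x : (n%:R : C) x = n%:R.
Proof. by rewrite cts_mulrn. Qed.

Lemma cts_bounded_lalg : bounded_lalg C.
Proof.
move=> f; have [k k0 fk] := cts_bounded f cX.
have [n kn] : exists n : nat, k <= n%:R.
  by exists (Num.bound k); rewrite ltW// archi_boundP.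
exists n; split; apply/cts_leE => x; have := fk x; rewrite ler_norml => /andP[h1 h2].
  by apply: le_trans h1; rewrite -[leLHS]/(- (n%:R : C) x) cts_natr lerN2.
by rewrite cts_natr (le_trans h2).
Qed.

Lemma cts_archimedean_lalg : archimedean_lalg C.
Proof.
move=> f g fg; apply/cts_leE => x; rewrite leNgt; apply/negP => fx0.
have fx0' : 0 < f x by [].
have := archi_boundP (divr_ge0 (normr_ge0 (g x)) (ltW fx0')).
set n := Num.bound _; rewrite ltr_pdivrMr// => h.
have /cts_leE/(_ x) := fg n; rewrite cts_mulrn -mulr_natl => h'.
by have := le_lt_trans (ler_norm (g x)) h; rewrite ltNge h'.
Qed.

Definition cts_bal : balType R := BalType cts_bounded_lalg cts_archimedean_lalg.

End CompactBal.

Lemma dist_max {R : realDomainType} (p q r t : R) :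
  `|Num.max p q - Num.max r t| <= `|p - r| + `|q - t|.
Proof.
have := lexx `|p - r|; have := lexx `|q - t|.
(* The distances on the right become variables u and v; those left on the other side then unfold
   into linear bounds. *)
move: {2 3}`|p - r| {2 3}`|q - t| => u v; rewrite !ler_norml.
by have [?|?] := leP p q; have [?|?] := leP r t; lra.
Qed.

Lemma dist_min {R : realDomainType} (p q r t : R) :
  `|Num.min p q - Num.min r t| <= `|p - r| + `|q - t|.
Proof.
rewrite -[leLHS]normrN opprD !oppr_min (le_trans (dist_max _ _ _ _))//.
by rewrite -!opprD !normrN.
Qed.

(** * The closure of the reflexive elements and the closure of the proximity *)

Section Nbal.
Context {R : realType} {A : balType R} (prec : A -> A -> Prop).
Hypothesis prox : reflexive_proximity prec.
Implicit Types (a b c d : A) (f g : continuousType (spectrum A) R).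

Local Notation S :=
  (nclosure [set phi c | c in reflexive_elts prec] : set (continuousType (spectrum A) R)).

Lemma reflexive_join a b : prec a a -> prec b b -> prec (a `|` b)%O (a `|` b)%O.
Proof.
move=> aa bb; apply: (prox_join prox).
  exact: (prox_trans prox (lexx _) aa (leUl _ _)).
exact: (prox_trans prox (lexx _) bb (leUr _ _)).
Qed.

Lemma reflexive_meet a b : prec a a -> prec b b -> prec (a `&` b)%O (a `&` b)%O.
Proof.
move=> aa bb; apply: (prox_meet prox).
  exact: (prox_trans prox (leIl _ _) aa (lexx _)).
exact: (prox_trans prox (leIr _ _) bb (lexx _)).
Qed.

Lemma reflexive_closureP f : S f <-> forall e : R, 0 < e ->
  exists2 c, prec c c & forall x, `|f x - phi c x| < e.
Proof.
rewrite nclosureP; last exact: spectrum_compact.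
split => h e e0; first by have [_ [c cc <-] fc] := h e e0; exists c.
by have [c cc fc] := h e e0; exists (phi c) => //; exists c.
Qed.

(** Treats sum, join and meet at once: each moves by at most the sum of the distances its arguments
    move. *)
Lemma reflexive_closure_op (op : A -> A -> A)
    (opC : continuousType (spectrum A) R -> continuousType (spectrum A) R ->
      continuousType (spectrum A) R) f g :
  (forall a b, prec a a -> prec b b -> prec (op a b) (op a b)) ->
  (forall a b x, `|opC f g x - phi (op a b) x| <=
    `|f x - phi a x| + `|g x - phi b x|) ->
  S f -> S g -> S (opC f g).
Proof.
move=> hop hC /reflexive_closureP Sf /reflexive_closureP Sg; apply/reflexive_closureP => e e0.
have e20 : 0 < e / 2 by rewrite divr_gt0.
have [[a aa fa] [b bb gb]] := (Sf _ e20, Sg _ e20).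
exists (op a b) => [|x]; first exact: hop.
by apply: le_lt_trans (hC a b x) _; have := fa x; have := gb x; lra.
Qed.

(** The product is Lipschitz only on bounded sets, so bounds on f and g enter, and (P7) needs
    nonnegative approximants. *)
Lemma reflexive_closure_mul f g : S f -> S g ->
  (forall x, 0 <= f x) -> (forall x, 0 <= g x) -> S (cts_mul f g).
Proof.
move=> Sf Sg f0 g0; have cX := @spectrum_compact R A.
have [k k0 fk] := cts_bounded f cX; have [l l0 gl] := cts_bounded g cX.
have nneg h : S h -> (forall x, 0 <= h x) -> forall e : R, 0 < e ->
    exists c, [/\ prec c c, 0 <= c & forall x, `|h x - phi c x| < e].
  move=> /reflexive_closureP Sh h0 e e0; have [c cc hc] := Sh e e0.
  (* Since h is nonnegative, passing to the positive part of c does not spoil the approximation. *)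
  exists (c `|` 0)%O; split; last 1 first.
  - move=> x; rewrite phiU -(scale0r (1 : A)) phi_scalar.
    have := hc x; have := h0 x; rewrite !ltr_norml.
    by have [?|?] := leP (phi c x) 0; lra.
  - apply: reflexive_join => //; rewrite -(scale0r (1 : A)); exact: prox_cst prox 0.
  - exact: leUr.
apply/reflexive_closureP => e e0.
(* With errors u and v, the product is off by at most u l + (k + 1) v, hence by at most N times the
   larger error. The cap 1 on the errors yields the bound k + 1 on [phi a]. *)
pose N := k + l + 1; have N0 : 0 < N by rewrite /N; lra.
have d0 : 0 < Num.min 1 (e / N) by rewrite lt_min ltr01 divr_gt0.
have [a [aa a0 fa]] := nneg f Sf f0 _ d0.
have [b [bb b0 gb]] := nneg g Sg g0 _ d0.
exists (a * b) => [|x]; first exact: (prox_mul prox).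
rewrite phiM -[cts_mul f g x]/(f x * g x).
have := fa x; rewrite lt_min => /andP[fa1 fae].
have := gb x; rewrite lt_min => /andP[gb1 gbe].
rewrite ltr_pdivlMr// in fae; rewrite ltr_pdivlMr// in gbe.
have -> : f x * g x - phi a x * phi b x =
    (f x - phi a x) * g x + phi a x * (g x - phi b x) by ring.
apply: le_lt_trans (ler_normD _ _) _; rewrite !normrM.
have hk := fk x; have hl := gl x.
have ha : `|phi a x| <= k + 1.
  have := ler_normB (f x) (f x - phi a x); rewrite subKr; lra.
have h1 := ler_wpM2l (normr_ge0 (f x - phi a x)) hl.
have h2 := ler_wpM2r (normr_ge0 (g x - phi b x)) ha.
set u := `|f x - phi a x| in fae h1 *; set v := `|g x - phi b x| in gbe h2 *.
have [uv|vu] := leP u v.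
  have : u * l <= v * l by rewrite ler_wpM2r.
  by move: gbe h1 h2; rewrite /N; nra.
have : (k + 1) * v <= (k + 1) * u by rewrite ler_wpM2l ?ltW//; lra.
by move: fae h1 h2; rewrite /N; nra.
Qed.

Lemma reflexive_closure_sbal : sub_sbal S.
Proof.
have cX := @spectrum_compact R A.
apply: (@sub_sbal_closed R (cts_bal cX)).
- move=> r; apply/reflexive_closureP => e e0; exists (r *: (1 : A)).
    exact: prox_cst prox r.
  by move=> x; rewrite phi_scalar [X in X - _]mulr1 subrr normr0.
- move=> f g; apply: (@reflexive_closure_op +%R cts_add).
    by move=> a b; exact: (prox_add prox).
  move=> a b x; rewrite phiD -[cts_add f g x]/(f x + g x) opprD addrACA.
  exact: ler_normD.
- move=> f g; apply: (@reflexive_closure_op (fun a b => a `|` b)%O cts_max).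
    exact: reflexive_join.
  move=> a b x; rewrite phiU -[cts_max f g x]/(Num.max (f x) (g x)).
  exact: dist_max.
- move=> f g; apply: (@reflexive_closure_op (fun a b => a `&` b)%O cts_min).
    exact: reflexive_meet.
  move=> a b x; rewrite phiI -[cts_min f g x]/(Num.min (f x) (g x)).
  exact: dist_min.
- by move=> f g Sf Sg /cts_leP f0 /cts_leP g0; exact: reflexive_closure_mul.
Qed.

(** (RP5) puts a reflexive element between the two members of a proximal pair that is e-close to f
    and g. *)
Lemma approximate_interpolant f g : rel_nclosure (phi_rel prec) f g ->
  forall e : R, 0 < e -> exists2 c, prec c c &
    forall x, f x - e < phi c x /\ phi c x < g x + e.
Proof.
move/(rel_nclosureP _ _ _ (@spectrum_compact R A)) => h e e0.
have [f' [g' [[a [b [ab -> ->]]] fa gb]]] := h e e0.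
have [c [ac cc cb]] := prox_interpolation prox ab.
exists c => // x; have := phi_le x (prox_le prox ac).
have := phi_le x (prox_le prox cb).
by have := fa x; have := gb x; rewrite !ltr_norml; split; lra.
Qed.

Lemma rel_nclosure_interpolant f g : rel_nclosure (phi_rel prec) f g ->
  exists s, [/\ S s, forall x, f x <= s x & forall x, s x <= g x].
Proof.
move=> fg; have p0 n : 0 < 2^-1 ^+ n :> R by rewrite exprn_gt0// invr_gt0.
have /choice[c hc] : forall n, exists c, prec c c /\
    forall x, f x - 2^-1 ^+ n < phi c x /\ phi c x < g x + 2^-1 ^+ n.
  by move=> n; have [c ? ?] := approximate_interpolant fg (p0 n); exists c.
pose eps n : A := 2^-1 ^+ n *: (1 : A).
pose fix s n : A := if n is m.+1
  then ((c m.+1 `|` (s m - eps m)) `&` (s m + eps m))%O else c 0%N.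
have sE n x : phi (s n.+1) x = Num.min
    (Num.max (phi (c n.+1) x) (phi (s n) x - 2^-1 ^+ n)) (phi (s n) x + 2^-1 ^+ n).
  by rewrite /= phiI phiU !phiD phiN phi_scalar.
(* Clamping preserves reflexivity because the scalars are reflexive by (P8). *)
have ss n : prec (s n) (s n).
  elim: n => [|n IH]; first exact: (hc 0%N).1.
  apply: reflexive_meet; last exact: (prox_add prox) IH (prox_cst prox _).
  apply: reflexive_join; first exact: (hc n.+1).1.
  rewrite /eps -scaleNr; exact: (prox_add prox) IH (prox_cst prox _).
(* By induction the upper clamp [s n] + 2^-n is at least f and the lower clamp [s n] - 2^-n is at
   most g. Neither clamp can therefore spoil the accuracy 2^-(n+1) of [c n.+1]. *)
have sb n x : f x - 2^-1 ^+ n <= phi (s n) x /\ phi (s n) x <= g x + 2^-1 ^+ n.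
  elim: n => [|n [IH1 IH2]]; first by have [_ /(_ x)[h1 h2]] := hc 0%N; rewrite !ltW.
  have [_ /(_ x)[]] := hc n.+1; have := p0 n; have := p0 n.+1.
  rewrite sE le_min le_max ge_min ge_max.
  move=> h0 h1 /ltW -> /ltW ->; split.
    by apply/andP; split => //; lra.
  by apply/orP; left; rewrite andTb; lra.
have sS n x : `|phi (s n.+1) x - phi (s n) x| <= 2^-1 ^+ n.
  rewrite sE; have := p0 n; move: (_ ^+ n) => d d0; set m := Num.min _ _.
  have h1 : phi (s n) x - d <= m.
    by rewrite le_min le_max lexx orbT /=; lra.
  have h2 : m <= phi (s n) x + d by rewrite ge_min lexx orbT.
  by rewrite ler_norml; lra.
have [l sl] := uniform_geometric_limit sS.
(* The factor 3 adds the distance 2 * 2^-n from [s n] to [l] and the slack 2^-n in [sb]. *)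
have slim (e : R) : 0 < e -> exists n, 3 * 2^-1 ^+ n < e.
  move=> e0; have e30 : 0 < e / 3 by rewrite divr_gt0.
  by have [n ?] := half_pow_lt e30; exists n; lra.
exists l; split.
- apply/reflexive_closureP => e e0; have [n ne] := slim _ e0; exists (s n) => // x.
  by rewrite distrC; apply: le_lt_trans (sl n x) _; have := p0 n; lra.
- move=> x; apply/ler_addgt0Pr => e e0; have [n ne] := slim _ e0.
  by have := sl n x; have [] := sb n x; rewrite ler_norml; lra.
- move=> x; apply/ler_addgt0Pr => e e0; have [n ne] := slim _ e0.
  by have := sl n x; have [] := sb n x; rewrite ler_norml; lra.
Qed.

Lemma rel_nclosure_of_interpolant f g s : S s ->
  (forall x, f x <= s x) -> (forall x, s x <= g x) ->
  rel_nclosure (phi_rel prec) f g.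
Proof.
move=> /reflexive_closureP Ss fs sg.
apply/(rel_nclosureP _ _ _ (@spectrum_compact R A)) => e e0.
have e20 : 0 < e / 2 by rewrite divr_gt0.
have [c cc sc] := Ss _ e20.
have [a fa] := phi_dense f e20; have [b gb] := phi_dense g e20.
(* Forcing the pair around the reflexive c makes it proximal by (P2). It stays close to f and g
   because f <= s <= g and c is close to s. *)
exists (phi (a `&` c)%O), (phi (b `|` c)%O); split.
- exists (a `&` c)%O, (b `|` c)%O; split => //.
  exact: (prox_trans prox (leIr _ _) cc (leUr _ _)).
- move=> x; have := fa x; have := sc x; have := fs x.
  by rewrite phiI !ltr_norml; have [?|?] := leP (phi a x) (phi c x); lra.
- move=> x; have := gb x; have := sc x; have := sg x.
  by rewrite phiU !ltr_norml; have [?|?] := leP (phi b x) (phi c x); lra.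
Qed.

End Nbal.

Theorem theorem6p2 (R : realType) (A : balType R) (prec : A -> A -> Prop) :
  is_nbal prec ->
  let S : set (continuousType (spectrum A) R) :=
    nclosure [set phi c | c in reflexive_elts prec] in
  let prec' := rel_nclosure (phi_rel prec) in
  sub_sbal S /\
  (forall f g : continuousType (spectrum A) R, prec' f g <-> prec_of S f g).
Proof.
move=> /nbal_proximity prox S prec'; split; first exact: reflexive_closure_sbal.
move=> f g; split => [/(rel_nclosure_interpolant prox)[s [Ss fs sg]]|[s [Ss fs sg]]].
  by exists s; split => //; exact/cts_leE.
by apply: (rel_nclosure_of_interpolant prox Ss); exact/cts_leE.
Qed.
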